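(* Let $N\ge 1$ be an integer and let $z,q$ be complex numbers with $|q|<1$ and $z\neq 0$. Let $F$ be the $1\times N$ board with weight function $F_w(i)=zq^i$ for $1\le i\le N$. For $0\le m\le N$, $$F(m):=\sum_{\substack{T\text{ a tiling of }F\\ \text{with exactly }m\text{ black tiles}}}W(T)=z^mq^{\frac{m(m+1)}{2}}\begin{bmatrix}N\\ m\end{bmatrix}.$$ Therefore $$\prod_{m=1}^{N}(1+zq^m)=\sum_{m=0}^{N}z^mq^{\frac{m(m+1)}{2}}\begin{bmatrix}N\\ m\end{bmatrix}.$$
   Context: $(q)_n:=\prod_{j=1}^{n}(1-q^j)$ (with $(q)_0=1$), and the Gaussian polynomial ($q$-binomial coefficient) is $\begin{bmatrix}N\\ m\end{bmatrix}:=\frac{(q)_N}{(q)_m(q)_{N-m}}$ if $0\le m\le N$, and $0$ otherwise. A tiling $T$ of a $1\times N$ board is a function $T:\{1,\dots,N\}\to\{\text{white},\text{black}\}$. Given the weight function $F_w$ of the board, the local weight of $T$ at position $i$ is $W_T(i)=F_w(i)$ if $T(i)=\text{black}$ and $W_T(i)=1$ if $T(i)=\text{white}$; the total weight is $W(T)=\prod_{i=1}^{N}W_T(i)$. *)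

(* Defs.v *)
From mathcomp Require Import all_boot all_order all_algebra.

Set Implicit Arguments.
Unset Strict Implicit.
Unset Printing Implicit Defensive.

Import GRing.Theory.
Local Open Scope ring_scope.

Definition qpoch (K : fieldType) (q : K) (n : nat) : K :=
  \prod_(1 <= j < n.+1) (1 - q ^+ j).

Definition gaussian (K : fieldType) (q : K) (N m : nat) : K :=
  if (m <= N)%N then qpoch q N / (qpoch q m * qpoch q (N - m)) else 0.

Definition color : finType := bool.
Definition white : color := false.
Definition black : color := true.

(* Positions 1, ..., N of the board are encoded by the ordinals 0, ..., N - 1:
   the ordinal i stands for position i.+1. *)
Definition tiling (N : nat) : finType := {ffun 'I_N -> color}.

(* A board of length N is given by its weight function Fw, of which only the
   values at 1, ..., N matter. *)
Definition local_weight (K : fieldType) (Fw : nat -> K) (N : nat)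
    (T : tiling N) (i : 'I_N) : K :=
  if T i == black then Fw i.+1 else 1.

Definition total_weight (K : fieldType) (Fw : nat -> K) (N : nat)
    (T : tiling N) : K :=
  \prod_(i < N) local_weight Fw T i.

Definition black_count (N : nat) (T : tiling N) : nat :=
  #|[set i : 'I_N | T i == black]|.

Definition tiling_sum (K : fieldType) (Fw : nat -> K) (N m : nat) : K :=
  \sum_(T : tiling N | black_count T == m) total_weight Fw T.

(* Main.v *)
Require Import Defs.
From mathcomp Require Import all_boot all_order all_algebra.
From mathcomp Require Import reals.
From mathcomp.real_closed Require Import complex.
From mathcomp Require Import ring.

                                                                         
                                                                         
                                                                              
                                                                         
                                                                             
                                                                        
                                                                         
                                                                             
                                                                             
                                                              

                                                                        
                                                                             
                                                                         
                                                                

Import Order.TTheory GRing.Theory Num.Theory.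
Local Open Scope ring_scope.
Local Open Scope complex_scope.

                                                                         
Definition board_poly {K : fieldType} (w : nat -> K) (N : nat) : {poly K} :=
  \prod_(i < N) (1 + w i.+1 *: 'X).

Lemma total_weight_monomial (K : fieldType) (w : nat -> K) (N : nat)
    (T : tiling N) :
  \prod_(i < N) (if T i == black then w i.+1 *: 'X else 1 : {poly K})
  = total_weight w T *: 'X^(black_count T).
Proof.
rewrite /total_weight /black_count -sum1_card -prodrXr.
rewrite [X in _ *: X]big_mkcond /= -scaler_prod.
apply: eq_bigr => i _; rewrite inE /local_weight.
by case: eqP => _; rewrite ?expr1 ?scale1r.
Qed.

                                                                              
                                                                    
Lemma coef_board_poly (K : fieldType) (w : nat -> K) (N m : nat) :
  (board_poly w N)`_m = tiling_sum w N m.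
Proof.
have -> : board_poly w N
    = \sum_(T : tiling N) total_weight w T *: 'X^(black_count T).
  transitivity (\prod_(i < N) \sum_(c : bool)
      (if c == black then w i.+1 *: 'X else 1 : {poly K})).
    by apply: eq_bigr => i _; rewrite big_bool addrC.
  rewrite bigA_distr_bigA.
  by apply: eq_bigr => T _; rewrite total_weight_monomial.
rewrite coef_sum /tiling_sum [RHS]big_mkcond; apply: eq_bigr => T _.
by rewrite coefZ coefXn eq_sym; case: eqP; rewrite ?mulr1 ?mulr0.
Qed.

Lemma tiling_sum_empty (K : fieldType) (w : nat -> K) (m : nat) :
  tiling_sum w 0 m = (m == 0%N)%:R.
Proof. by rewrite -coef_board_poly /board_poly big_ord0 coef1. Qed.

                                                                   
Lemma tiling_sumS (K : fieldType) (w : nat -> K) (N m : nat) :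
  tiling_sum w N.+1 m.+1 = tiling_sum w N m.+1 + w N.+1 * tiling_sum w N m.
Proof.
rewrite -!coef_board_poly /board_poly big_ord_recr /= mulrDr mulr1 coefD.
by rewrite -scalerAr coefZ coefMX.
Qed.

Lemma tiling_sum_white (K : fieldType) (w : nat -> K) (N : nat) :
  tiling_sum w N 0 = 1.
Proof.
elim: N => [|N IHN]; first by rewrite tiling_sum_empty.
rewrite -coef_board_poly /board_poly big_ord_recr /= mulrDr mulr1 coefD.
by rewrite -scalerAr coefZ coefMX mulr0 addr0 -[LHS]/((board_poly w N)`_0)
  coef_board_poly.
Qed.

Lemma qpochS (K : fieldType) (q : K) (n : nat) :
  qpoch q n.+1 = qpoch q n * (1 - q ^+ n.+1).
Proof. by rewrite /qpoch big_nat_recr. Qed.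

Lemma qpoch0 (K : fieldType) (q : K) : qpoch q 0 = 1.
Proof. by rewrite /qpoch big_geq. Qed.

Lemma triangularS (m : nat) :
  ((m.+1 * (m.+1 + 1)) %/ 2 = m.+1 + (m * (m + 1)) %/ 2)%N.
Proof. by rewrite -divnMDl //; congr (_ %/ 2)%N; ring. Qed.

Section NotRootOfUnity.

Variables (K : fieldType) (q : K).
Hypothesis q_expr_neq1 : forall j : nat, (0 < j)%N -> 1 - q ^+ j != 0.

Lemma qpoch_neq0 (n : nat) : qpoch q n != 0.
Proof.
elim: n => [|n IHn]; first by rewrite qpoch0 oner_neq0.
by rewrite qpochS mulf_neq0 ?q_expr_neq1.
Qed.

Lemma gaussian_n0 (N : nat) : gaussian q N 0 = 1.
Proof. by rewrite /gaussian leq0n subn0 qpoch0 mul1r divff ?qpoch_neq0. Qed.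

Lemma gaussian_nn (N : nat) : gaussian q N N = 1.
Proof. by rewrite /gaussian leqnn subnn qpoch0 mulr1 divff ?qpoch_neq0. Qed.

                                                                            
                                                                   
Lemma gaussianS (N m : nat) : (m <= N)%N ->
  gaussian q N.+1 m.+1 = gaussian q N m.+1 + q ^+ (N - m) * gaussian q N m.
Proof.
rewrite leq_eqVlt => /predU1P[->|lt_mN].
  by rewrite !gaussian_nn subnn mulr1 /gaussian ltnn add0r.
                                                                        
rewrite -(subnKC lt_mN); move: (N - m.+1)%N => k.
rewrite /gaussian !addSn !ltnS !leq_addr leqW ?leq_addr //.
rewrite subSS subSS addKn -addnS addKn !addnS.
rewrite !qpochS -addnS -addSn.
have -> : q ^+ (m.+1 + k.+1) = q ^+ m.+1 * q ^+ k.+1 by rewrite exprD.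
by field; rewrite !q_expr_neq1 ?qpoch_neq0.
Qed.

                                                                             
                                                            
Lemma tiling_sum_gaussian (z : K) (N m : nat) :
  tiling_sum (fun i : nat => z * q ^+ i) N m
  = z ^+ m * q ^+ ((m * (m + 1)) %/ 2) * gaussian q N m.
Proof.
elim: N m => [|N IHN] [|m].
- by rewrite tiling_sum_empty gaussian_n0 !mul1r.
- by rewrite tiling_sum_empty /gaussian mulr0.
- by rewrite tiling_sum_white gaussian_n0 !mul1r.
rewrite tiling_sumS !IHN.
have [le_mN|lt_Nm] := leqP m N; last first.
  by rewrite /gaussian ltnS (leqNgt m N) lt_Nm ltnNge (ltnW lt_Nm) !mulr0 addr0.
have -> : q ^+ N.+1 = q ^+ m.+1 * q ^+ (N - m) by rewrite -exprD addSn subnKC.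
by rewrite gaussianS // triangularS [z ^+ m.+1]exprS exprD; ring.
Qed.

                                                                               
                                                                     
Lemma prod_gaussian (z : K) (N : nat) :
  \prod_(1 <= m < N.+1) (1 + z * q ^+ m)
  = \sum_(0 <= m < N.+1) z ^+ m * q ^+ ((m * (m + 1)) %/ 2) * gaussian q N m.
Proof.
pose p := board_poly (fun i => z * q ^+ i) N.
have size_p : (size p <= N.+1)%N.
  apply/leq_sizeP => m lt_Nm; rewrite coef_board_poly tiling_sum_gaussian.
  by rewrite /gaussian leqNgt lt_Nm mulr0.
transitivity p.[1].
  rewrite horner_prod big_add1 /= big_mkord; apply: eq_bigr => i _.
  by rewrite !hornerE.
rewrite (horner_coef_wide _ size_p) big_mkord; apply: eq_bigr => m _.
by rewrite expr1n mulr1 coef_board_poly tiling_sum_gaussian.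
Qed.

End NotRootOfUnity.

Lemma subr1_expr_neq0 (K : numFieldType) (q : K) (j : nat) :
  `|q| < 1 -> (0 < j)%N -> 1 - q ^+ j != 0.
Proof.
move=> q_lt1 j_gt0; rewrite subr_eq0; apply/eqP => /(congr1 Num.norm) /eqP.
by rewrite normrX normr1 eq_sym lt_eqF // exprn_ilt1 // -lt0n.
Qed.

Theorem theorem3p1 (R : realType) (N : nat) (z q : R[i])
    (hN : (1 <= N)%N) (hq : `|q| < 1) (hz : z != 0) :
  (forall m : nat, (m <= N)%N ->
     tiling_sum (fun i : nat => z * q ^+ i) N m
     = z ^+ m * q ^+ ((m * (m + 1)) %/ 2) * gaussian q N m)
  /\
  \prod_(1 <= m < N.+1) (1 + z * q ^+ m)
  = \sum_(0 <= m < N.+1) z ^+ m * q ^+ ((m * (m + 1)) %/ 2) * gaussian q N m.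
Proof.
have q_expr_neq1 j : (0 < j)%N -> 1 - q ^+ j != 0 by exact: subr1_expr_neq0.
split=> [m _|]; first exact: tiling_sum_gaussian.
exact: prod_gaussian.
Qed.
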